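(* Let $n\ge 2$. The $n\times n$ matrix $$C_{n} = \begin{pmatrix} 3 & 7 & 15 & 31 & 63 & \cdots & 2^{n+1}-1 \\ 1 & 3 & 7 & 15 & 31 & \cdots & 2^{n}-1 \\ 0 & 1 & 3 & 7 & 15 & \cdots & 2^{n-1}-1 \\ 0 & 0 & 1 & 3 & 7 & \cdots & 2^{n-2}-1 \\ 0 & 0 & 0 & 1 & 3 & \cdots & 2^{n-3}-1 \\ \vdots & \vdots & \vdots & \vdots & \vdots & \ddots & \vdots \\ 0 & 0 & 0 & 0 & 0 & \cdots & 3 \end{pmatrix}$$ (whose $(p,q)$ entry is $2^{q-p+2}-1$ if $q\ge p-1$ and $0$ if $q<p-1$) is a production matrix for plane connected graphs of point sets in convex position; that is, $v^{i+1}=C_n v^i$ for all $i$ with $2\le i\le n$.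
   Context: A geometric graph on a finite point set $\mathcal S\subseteq\mathbb R^2$ has vertex set $\mathcal S$ and edges that are straight-line segments with endpoints in $\mathcal S$; it is plane if no two edges intersect except at common endpoints. Graphs with $i$ vertices are considered on points $p_1,\dots,p_i$ in convex position labelled in counter-clockwise order. Two vertices are visible (from each other) if the line segment connecting them does not intersect the interior of any edge of the graph. The visibility degree of the root vertex $p_i$ of a graph on $\{p_1,\dots,p_i\}$ is the number of vertices visible from an additional vertex $p_{i+1}$ inserted between $p_i$ and $p_1$ in convex position, minus $2$. For $2\le i\le n+1$, $v^i$ is the $n$-dimensional column vector whose $j$-th entry is the number of connected plane geometric graphs on $i$ points in convex position whose root vertex has visibility degree $j-1$ (so $v^2=(1,0,\dots,0)^\top$). A production matrix is a matrix satisfying $v^{i+1}=C_nv^i$. *)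

(* Defs.v *)
From HB Require Import structures.
From mathcomp Require Import all_boot all_order all_algebra.
From mathcomp Require Import boolp classical_sets reals.

Set Implicit Arguments.
Unset Strict Implicit.
Unset Printing Implicit Defensive.

Import Order.TTheory GRing.Theory Num.Theory.
Local Open Scope ring_scope.

Section Geometry.
Variable R : realType.
Local Notation point := 'rV[R]_2.

Definition segment (a b : point) : set point :=
  [set x | exists t : R, 0 <= t <= 1 /\ x = (1 - t) *: a + t *: b]%classic.

Definition open_segment (a b : point) : set point :=
  [set x | exists t : R, 0 < t < 1 /\ x = (1 - t) *: a + t *: b]%classic.

(* Twice the signed area of the triangle a b c. *)
Definition orientation (a b c : point) : R :=
  (b 0 0 - a 0 0) * (c 0 1 - a 0 1) - (b 0 1 - a 0 1) * (c 0 0 - a 0 0).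

Section Positions.
Variables (m : nat) (p : 'I_m -> point).

(* No point is a convex combination of the other ones. *)
Definition convex_position : Prop :=
  forall k : 'I_m, ~ exists w : 'I_m -> R,
    [/\ forall j, 0 <= w j, w k = 0, \sum_j w j = 1 & p k = \sum_j w j *: p j].

(* Walking through the points in the order of their labels, every triple is
   traversed counter-clockwise; consecutive triples alone would not suffice
   (they also turn left in a pentagram). *)
Definition ccw_labelled : Prop :=
  forall i j k : 'I_m, (i < j < k)%N -> 0 < orientation (p i) (p j) (p k).

Definition convex_ccw : Prop := convex_position /\ ccw_labelled.

End Positions.

(* The points of p followed by x.  If the result is convex_ccw, then x lies
   between the last and the first point of p in the cyclic order. *)
Definition add_point (m : nat) (p : 'I_m -> point) (x : point)
    (k : 'I_m.+1) : point :=
  if unlift ord_max k is Some j then p j else x.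

Section GeometricGraphs.
Variables (m : nat) (p : 'I_m -> point).

(* A geometric graph on the points p is given by its set E of edges, each of
   which is a pair of labels; the edge [set u; v] is drawn as the segment from
   p u to p v. *)
Implicit Type E : {set {set 'I_m}}.

Definition is_graph E : bool := [forall e in E, #|e| == 2%N].

Definition adjacent E : rel 'I_m := fun u v => [set u; v] \in E.

Definition connected_graph E : bool := [forall u, forall v, connect (adjacent E) u v].

Definition plane_graph E : Prop :=
  forall u v w z : 'I_m, adjacent E u v -> adjacent E w z ->
    [set u; v] != [set w; z] ->
    forall x, segment (p u) (p v) x -> segment (p w) (p z) x ->
      exists2 k : 'I_m, k \in [set u; v] :&: [set w; z] & x = p k.

Definition visible E (x y : point) : Prop :=
  forall u v : 'I_m, adjacent E u v ->
    (segment x y `&` open_segment (p u) (p v) = set0)%classic.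

(* Visibility degree of the last vertex of p, where x is the additional point. *)
Definition visibility_degree (x : point) E : nat :=
  (#|[pred k : 'I_m | `[< visible E x (p k) >]]| - 2)%N.

Definition connected_plane_graphs : {set {set {set 'I_m}}} :=
  finset (fun E => [&& is_graph E, connected_graph E & `[< plane_graph E >]]).

(* Entry j, counted from 0, is the number of graphs with degree j. *)
Definition visibility_vector (n : nat) (x : point) : 'cV[int]_n :=
  \col_(j < n)
    (#|[pred E in connected_plane_graphs | visibility_degree x E == j]|)%:Z.

End GeometricGraphs.
End Geometry.

(* Here p and q are counted from 0; the truncated exponent q + 2 - p is exact
   whenever it is used. *)
Definition production_mx (n : nat) : 'M[int]_n :=
  \matrix_(p < n, q < n) (if (p <= q.+1)%N then 2 ^+ (q + 2 - p) - 1 else 0).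

(* Main.v *)
Require Import Defs.
From mathcomp Require Import all_boot all_order all_algebra.
From mathcomp Require Import zify ring lra.

(* In convex position a graph is plane iff no two edges alternate, and the
   vertex k is visible from the new point iff no edge joins a vertex before k
   to one after k.  Cutting at its inner visible vertices makes a connected
   plane graph a chain of blocks, each having an edge between its two end vertices.
   Let B be the generating function of blocks and C = 1 / (1 - B) that of
   all graphs, X marking length.  Deleting the outer edge of a block
   leaves either a connected graph that is not a block or two graphs on adjacent
   intervals, so 2 B = C - 1 + X C^2.  Hence B (1 - 2 B) = X C, that is
   B = X \sum_q (2^(q+1) - 1) B^q; multiplying by B^p and comparing coefficients
   gives the row p of the production matrix. *)

Set Implicit Arguments.
Unset Strict Implicit.
Unset Printing Implicit Defensive.
Import Order.TTheory GRing.Theory Num.Theory.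

(** * Counting finite sets by decompositions *)

Lemma card_setX_bij (T T1 T2 : finType) (S : {set T}) (A : {set T1})
    (B : {set T2}) (f1 : T -> T1) (f2 : T -> T2) (h : T1 -> T2 -> T) :
  (forall E, E \in S -> [/\ f1 E \in A, f2 E \in B & h (f1 E) (f2 E) = E]) ->
  (forall E1 E2, E1 \in A -> E2 \in B ->
     [/\ h E1 E2 \in S, f1 (h E1 E2) = E1 & f2 (h E1 E2) = E2]) ->
  #|S| = #|A| * #|B|.
Proof.
move=> fP hP; rewrite -cardsX -(card_in_imset (f := fun E => (f1 E, f2 E))).
  apply: eq_card => -[E1 E2]; rewrite in_setX; apply/imsetP/andP => [[E ES]|].
    by case=> -> ->; case: (fP E ES).
  move=> [/= E1A E2B]; exists (h E1 E2); case: (hP _ _ E1A E2B) => //.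
  by move=> _ -> ->.
move=> E E' /fP[_ _ eE] /fP[_ _ eE'] [e1 e2].
by rewrite -eE e1 e2 eE'.
Qed.

(** Each [E] of [S] lies in exactly one class [P c], so the sum over classes counts it once. *)
Lemma card_exists_unique (T I : finType) (S : {set T}) (Q : pred I)
    (P : I -> pred T) :
  (forall E, E \in S -> exists2 c, Q c & P c E) ->
  (forall E c c', E \in S -> Q c -> Q c' -> P c E -> P c' E -> c = c') ->
  #|S| = \sum_(c | Q c) #|[set E in S | P c E]|.
Proof.
move=> exP unP.
under eq_bigr => c _ do rewrite -sum1_card.
under eq_bigr => c _ do under eq_bigl => E do rewrite inE.
rewrite (exchange_big_dep (mem S)) /=; last by move=> c E _ /andP[].
rewrite -sum1_card; apply: eq_bigr => E ES.
have [c Qc Pc] := exP E ES.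
rewrite (bigD1 c) /=; last by rewrite Qc ES.
rewrite big1 // => c' /andP[/andP[Qc' /andP[_ Pc']]] /eqP[].
exact: (unP E).
Qed.

(** An edge need only go to a path, possibly of length 0, so [r] may contract edges, as the
    retractions onto subintervals do. *)
Lemma connect_map (T : finType) (e e' : rel T) (r : T -> T) (x y : T) :
  (forall u v, e u v -> connect e' (r u) (r v)) ->
  connect e x y -> connect e' (r x) (r y).
Proof.
move=> rP /connectP[s]; elim: s x => [|z s IHs] x /=; first by move=> _ ->.
move=> /andP[xz zs] ys; apply: connect_trans (rP _ _ xz) _.
exact: IHs.
Qed.

(** * Connected noncrossing graphs on intervals of labels *)

Section Graphs.
Variable m : nat.
Implicit Types (E : {set {set 'I_m}}) (u v w z : 'I_m).

(** Bounding [u] also bounds [v], because [adjacent] is symmetric. *)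
Definition supported E a b :=
  [forall u : 'I_m, forall v : 'I_m, adjacent E u v ==> (a <= u <= b)].

Definition noncrossing E :=
  [forall u : 'I_m, forall v : 'I_m, forall w : 'I_m, forall z : 'I_m,
    ~~ [&& u < w, w < v, v < z, adjacent E u v & adjacent E w z]].

Definition connected_on E a b :=
  [forall u : 'I_m, forall v : 'I_m,
    [&& a <= u <= b & a <= v <= b] ==> connect (adjacent E) u v].

Definition covered E k :=
  [exists u : 'I_m, exists v : 'I_m, [&& u < k, k < v & adjacent E u v]].

(* The lock keeps [inE] from expanding membership in this set. *)
Definition interval_graphs a b : {set {set {set 'I_m}}} :=
  locked (finset (fun E =>
    [&& is_graph E, supported E a b, noncrossing E & connected_on E a b])).

(** Leaving out the end vertices [a] and [b] matches the subtraction of 2 in the visibility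
    degree. *)
Definition degree E a b := #|[set k : 'I_m | (a < k < b) && ~~ covered E k]|.

Definition degree_graphs a b d :=
  [set E in interval_graphs a b | degree E a b == d].

Definition restrict E a b : {set {set 'I_m}} :=
  [set e in E | [forall k in e, a <= k <= b]].

Lemma adjacentC E u v : adjacent E u v = adjacent E v u.
Proof. by rewrite /adjacent setUC. Qed.

Lemma adjacent_neq E u v : is_graph E -> adjacent E u v -> u != v.
Proof.
move=> /forall_inP gE uv; have := gE _ uv; apply: contraTneq => ->.
by rewrite setUid cards1.
Qed.

Lemma adjacentU E1 E2 u v :
  adjacent (E1 :|: E2) u v = adjacent E1 u v || adjacent E2 u v.
Proof. by rewrite /adjacent inE. Qed.

Lemma adjacent_restrict E a b u v :
  adjacent (restrict E a b) u v
    = [&& adjacent E u v, a <= u <= b & a <= v <= b].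
Proof.
rewrite /adjacent inE; case: (_ \in E) => //=.
apply/forall_inP/andP => [H|[ua vb] k]; last by rewrite !inE => /pred2P[]->.
by split; apply: H; rewrite !inE eqxx ?orbT.
Qed.

Lemma eq_pair u v w z : u < v -> w < z ->
  ([set u; v] == [set w; z]) = (u == w) && (v == z).
Proof.
move=> uv wz; apply/eqP/andP => [/setP H|[/eqP-> /eqP->]//].
move: (H u) (H v) (H w) (H z); rewrite !inE !eqxx ?orbT /= => /esym H1 /esym H2 H3 H4.
move: H1 H2 H3 H4; rewrite -!val_eqE /=; lia.
Qed.

Lemma is_graph_sub E E' : E' \subset E -> is_graph E -> is_graph E'.
Proof.
move=> /subsetP sE /forall_inP gE; apply/forall_inP => e /sE; exact: gE.
Qed.

Lemma is_graphU E1 E2 : is_graph E1 -> is_graph E2 -> is_graph (E1 :|: E2).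
Proof.
move=> /forall_inP g1 /forall_inP g2; apply/forall_inP => e.
by rewrite inE => /orP[/g1|/g2].
Qed.

Lemma is_graph1 u v : u < v -> is_graph [set [set u; v]].
Proof.
move=> uv; apply/forall_inP => e /set1P ->; rewrite cards2.
by have -> : u != v by rewrite -val_eqE /= ltn_eqF.
Qed.

Lemma restrict_sub E a b : restrict E a b \subset E.
Proof. by apply/subsetP => e; rewrite inE => /andP[]. Qed.

Lemma edgeP E e : is_graph E -> e \in E ->
  exists u v : 'I_m, u < v /\ e = [set u; v].
Proof.
move=> /forall_inP gE /gE /cards2P[u [v [uv ->]]].
have [lt_uv|lt_vu|euv] := ltngtP u v; first by exists u, v.
  by exists v, u; rewrite setUC.
by move: uv; rewrite -val_eqE /= euv eqxx.
Qed.

Lemma graph_eq E1 E2 : is_graph E1 -> is_graph E2 ->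
  (forall u v, u < v -> adjacent E1 u v = adjacent E2 u v) -> E1 = E2.
Proof.
move=> g1 g2 H; apply/setP => e; apply/idP/idP => eE.
  have [u [v [uv ee]]] := edgeP g1 eE; move: eE.
  by rewrite ee -/(adjacent E1 u v) H.
have [u [v [uv ee]]] := edgeP g2 eE; move: eE.
by rewrite ee -/(adjacent E2 u v) -H.
Qed.

Lemma supportedP E a b :
  reflect (forall u v, adjacent E u v -> a <= u <= b /\ a <= v <= b)
          (supported E a b).
Proof.
apply: (iffP idP) => [/'forall_'forall_implyP H u v uv|H].
  by split; [exact: H uv | apply: (H v u); rewrite adjacentC].
by apply/'forall_'forall_implyP => u v /H[].
Qed.

Lemma noncrossingP E :
  reflect (forall u v w z, u < w -> w < v -> v < z ->
             adjacent E u v -> adjacent E w z -> False)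
          (noncrossing E).
Proof.
apply: (iffP idP).
  move=> /forallP H u v w z uw wv vz uv wz.
  move: (H u) => /forallP/(_ v)/forallP/(_ w)/forallP/(_ z).
  by rewrite uw wv vz uv wz.
move=> H; apply/forallP => u; apply/forallP => v; apply/forallP => w.
apply/forallP => z; apply/negP => /and5P[uw wv vz uv wz].
exact: (H u v w z).
Qed.

Lemma connected_onP E a b :
  reflect (forall u v, a <= u <= b -> a <= v <= b -> connect (adjacent E) u v)
          (connected_on E a b).
Proof.
apply: (iffP idP) => [/'forall_'forall_implyP H u v ua vb|H].
  by apply: H; rewrite ua.
by apply/'forall_'forall_implyP => u v /andP[]; exact: H.
Qed.

Lemma coveredP E k :
  reflect (exists u v, [/\ u < k, k < v & adjacent E u v]) (covered E k).
Proof.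
apply: (iffP existsP) => [[u /existsP[v /and3P[]]]|[u [v [uk kv uv]]]].
  by exists u, v.
by exists u; apply/existsP; exists v; rewrite uk kv.
Qed.

Lemma interval_graphsP E a b :
  reflect [/\ is_graph E, supported E a b, noncrossing E & connected_on E a b]
          (E \in interval_graphs a b).
Proof. rewrite /interval_graphs -lock inE; exact: and4P. Qed.

Lemma mem_degree_graphs E a b d :
  (E \in degree_graphs a b d)
    = (E \in interval_graphs a b) && (degree E a b == d).
Proof. by rewrite inE. Qed.

Lemma connect_adjacentC E : connect_sym (adjacent E).
Proof.
by apply: sym_connect_sym => u v; rewrite adjacentC.
Qed.


Lemma sub_noncrossing E E' : E' \subset E -> noncrossing E -> noncrossing E'.
Proof.
move=> /subsetP sE /noncrossingP nE; apply/noncrossingP => u v w z uw wv vz uv wz.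
by apply: (nE u v w z) => //; apply: sE.
Qed.

(* The retraction r maps paths of E to paths of the restriction, which is
   therefore connected. *)
Lemma restrict_interval_graphs E a b a' b' (r : 'I_m -> 'I_m) :
  E \in interval_graphs a b -> a <= a' -> b' <= b ->
  (forall u, a' <= u <= b' -> r u = u) ->
  (forall u v, u < v -> adjacent E u v -> r u = r v \/ a' <= u /\ v <= b') ->
  restrict E a' b' \in interval_graphs a' b'.
Proof.
move=> /interval_graphsP[gE sE nE cE] aa' bb' rid rP.
have rE u v : u < v -> adjacent E u v ->
    connect (adjacent (restrict E a' b')) (r u) (r v).
  move=> uv Euv; have [->//|[a'u vb']] := rP _ _ uv Euv.
  rewrite !rid; try lia.
  by apply: connect1; rewrite adjacent_restrict Euv /=; lia.
apply/interval_graphsP; split.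
- exact: is_graph_sub (restrict_sub _ _ _) gE.
- by apply/supportedP => u v; rewrite adjacent_restrict => /and3P[].
- exact: sub_noncrossing (restrict_sub _ _ _) nE.
apply/connected_onP => u v ua vb; rewrite -(rid u) // -(rid v) //.
apply: (connect_map (e := adjacent E)); last first.
  by apply: (connected_onP _ _ _ cE); lia.
move=> x z; have [xz|zx|/val_inj->//] := ltngtP x z; first exact: rE.
by rewrite adjacentC connect_adjacentC; exact: rE.
Qed.

Lemma uncoveredP E k u v : ~~ covered E k -> adjacent E u v -> u < k -> v <= k.
Proof.
move=> /coveredP ck uv uk; rewrite leqNgt; apply/negP => kv.
by apply: ck; exists u, v.
Qed.

(** * Cutting and gluing at an uncovered vertex *)

(** The retraction sends every vertex after [c] to [c]. No edge passes over [c], so each edge is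
    kept or contracted to [c]. *)
Lemma restrict_left E a b c : E \in interval_graphs a b -> a <= c <= b -> b < m ->
  ~~ covered E c -> restrict E a c \in interval_graphs a c.
Proof.
move=> GE acb bm ck; have cm : c < m by lia.
have /interval_graphsP[_ /supportedP sE _ _] := GE.
apply: (restrict_interval_graphs
          (r := fun u => if u <= c then u else Ordinal cm)) GE _ _ _ _; try lia.
  by move=> u /andP[_ ->].
move=> u v uv Euv; have [su sv] := sE _ _ Euv.
have := uncoveredP ck Euv.
have [uc|uc|/= uc] := ltngtP u c; first by right; lia.
  by left; case: ifP => //; lia.
by left; case: ifP => [|_]; [lia|exact: val_inj].
Qed.

Lemma restrict_right E a b c : E \in interval_graphs a b -> a <= c <= b -> b < m ->
  ~~ covered E c -> restrict E c b \in interval_graphs c b.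
Proof.
move=> GE acb bm ck; have cm : c < m by lia.
have /interval_graphsP[_ /supportedP sE _ _] := GE.
apply: (restrict_interval_graphs
          (r := fun u => if c <= u then u else Ordinal cm)) GE _ _ _ _; try lia.
  by move=> u /andP[-> _].
move=> u v uv Euv; have [su sv] := sE _ _ Euv.
have := uncoveredP ck Euv.
have [uc|uc|/= uc] := ltngtP c u; [by right; lia | | by right; lia].
move=> /(_ isT) vc; left; case: ifP => [cv|//]; apply: val_inj => /=; lia.
Qed.

Lemma is_graph_restrict E a b : is_graph E -> is_graph (restrict E a b).
Proof. exact: is_graph_sub (restrict_sub _ _ _). Qed.

(** The case [c' = c] serves gluing at a common vertex, the case [c' = c.+1] two adjacent intervals.
    An edge of [E2] inside the first interval would have to be a loop at [c]. *)
Lemma restrictUl E1 E2 a c c' b : c <= c' ->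
  E1 \in interval_graphs a c -> E2 \in interval_graphs c' b ->
  restrict (E1 :|: E2) a c = E1.
Proof.
move=> cc /interval_graphsP[g1 /supportedP s1 _ _].
move=> /interval_graphsP[g2 /supportedP s2 _ _].
apply: graph_eq => //; first exact/is_graph_restrict/is_graphU.
move=> u v uv; rewrite adjacent_restrict adjacentU.
case A1: (adjacent E1 u v); first by have [-> ->] := s1 _ _ A1.
case A2: (adjacent E2 u v) => //=; have := s2 _ _ A2; lia.
Qed.

Lemma restrictUr E1 E2 a c c' b : c <= c' ->
  E1 \in interval_graphs a c -> E2 \in interval_graphs c' b ->
  restrict (E1 :|: E2) c' b = E2.
Proof.
move=> cc /interval_graphsP[g1 /supportedP s1 _ _].
move=> /interval_graphsP[g2 /supportedP s2 _ _].
apply: graph_eq => //; first exact/is_graph_restrict/is_graphU.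
move=> u v uv; rewrite adjacent_restrict adjacentU.
case A2: (adjacent E2 u v); first by rewrite orbT; have [-> ->] := s2 _ _ A2.
case A1: (adjacent E1 u v) => //=; have := s1 _ _ A1; lia.
Qed.

Lemma noncrossingU E1 E2 a c c' b : c <= c' ->
  E1 \in interval_graphs a c -> E2 \in interval_graphs c' b ->
  noncrossing (E1 :|: E2).
Proof.
move=> cc /interval_graphsP[_ /supportedP s1 /noncrossingP n1 _].
move=> /interval_graphsP[_ /supportedP s2 /noncrossingP n2 _].
apply/noncrossingP => u v w z uw wv vz; rewrite !adjacentU.
move=> /orP[uv|uv] /orP[wz|wz]; [exact: n1 uv wz| | |exact: n2 uv wz].
  by have := s1 _ _ uv; have := s2 _ _ wz; lia.
by have := s2 _ _ uv; have := s1 _ _ wz; lia.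
Qed.

Lemma connectUl E1 E2 u v :
  connect (adjacent E1) u v -> connect (adjacent (E1 :|: E2)) u v.
Proof.
by apply: connect_sub => x z xz; apply: connect1; rewrite adjacentU xz.
Qed.

Lemma connectUr E1 E2 u v :
  connect (adjacent E2) u v -> connect (adjacent (E1 :|: E2)) u v.
Proof. by rewrite setUC; exact: connectUl. Qed.

Lemma connected_on_root E a b w : 
  (forall u, a <= u <= b -> connect (adjacent E) u w) -> connected_on E a b.
Proof.
move=> H; apply/connected_onP => u v ua vb.
by apply: connect_trans (H u ua) _; rewrite connect_adjacentC; exact: H.
Qed.

Lemma interval_graphsU E1 E2 a b c : a <= c <= b -> b < m ->
  E1 \in interval_graphs a c -> E2 \in interval_graphs c b ->
  E1 :|: E2 \in interval_graphs a b.
Proof.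
move=> acb bm G1 G2; have cm : c < m by lia.
have /interval_graphsP[g1 /supportedP s1 _ /connected_onP c1] := G1.
have /interval_graphsP[g2 /supportedP s2 _ /connected_onP c2] := G2.
apply/interval_graphsP; split.
- exact: is_graphU.
- apply/supportedP => u v; rewrite adjacentU => /orP[/s1|/s2]; lia.
- exact: noncrossingU G1 G2.
apply: (@connected_on_root _ _ _ (Ordinal cm)) => u ub.
have [uc|cu] := leqP u c; first by apply: connectUl; apply: c1 => /=; lia.
by apply: connectUr; apply: c2 => /=; lia.
Qed.

Lemma uncoveredU E1 E2 a b c :
  E1 \in interval_graphs a c -> E2 \in interval_graphs c b ->
  ~~ covered (E1 :|: E2) c.
Proof.
move=> /interval_graphsP[_ /supportedP s1 _ _] /interval_graphsP[_ /supportedP s2 _ _].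
apply/coveredP => -[u [v [uc cv]]]; rewrite adjacentU => /orP[/s1|/s2]; lia.
Qed.

Lemma interval_graphs_split E a b c : E \in interval_graphs a b ->
  ~~ covered E c -> restrict E a c :|: restrict E c b = E.
Proof.
move=> /interval_graphsP[gE /supportedP sE _ _] ck.
apply: graph_eq => //; first by apply: is_graphU; exact: is_graph_restrict.
move=> u v uv; rewrite adjacentU !adjacent_restrict.
case Euv: (adjacent E u v) => //=.
have := sE _ _ Euv; have := uncoveredP ck Euv; lia.
Qed.

Lemma degree_eq E E' a b : (forall k, a < k < b -> covered E k = covered E' k) ->
  degree E a b = degree E' a b.
Proof.
move=> H; apply: eq_card => k; rewrite !inE; case akb: (a < k < b) => //=.
by rewrite H.
Qed.

(** An edge covering an inner vertex and leaving the subinterval would cover [a'] or [b']. *)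
Lemma degree_restrict E a b a' b' : E \in interval_graphs a b ->
  a <= a' -> a' <= b' -> b' <= b -> ~~ covered E a' -> ~~ covered E b' ->
  degree (restrict E a' b') a' b' = degree E a' b'.
Proof.
move=> /interval_graphsP[gE /supportedP sE _ _] aa ab bb ca cb.
apply: degree_eq => k akb; apply/coveredP/coveredP => -[u [v [uk kv]]].
  by rewrite adjacent_restrict => /and3P[*]; exists u, v.
move=> Euv; exists u, v; rewrite adjacent_restrict Euv uk kv; split => //=.
have := sE _ _ Euv; have := uncoveredP ca Euv; have := uncoveredP cb Euv; lia.
Qed.

(** The successor counts [c] itself. *)
Lemma degree_split E a b c : a < c < b -> b < m -> ~~ covered E c ->
  degree E a b = degree E a c + (degree E c b).+1.
Proof.
move=> acb bm cc; have cm : c < m by lia.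
rewrite /degree -[X in _ + X]add1n addnA -(cards1 (Ordinal cm)).
rewrite -cardsUI (_ : _ :&: _ = set0) ?cards0 ?addn0; last first.
  by apply/setP => k; rewrite !inE -val_eqE /=; lia.
rewrite -cardsUI (_ : _ :&: _ = set0) ?cards0 ?addn0; last first.
  by apply/setP => k; rewrite !inE -val_eqE /=; lia.
apply: eq_card => k; rewrite !inE -val_eqE /=.
have [->|] := eqVneq (val k) c; first by rewrite cc acb /= orbT.
case: (covered E k) => /=; lia.
Qed.

Lemma boundary_uncovered E a b : E \in interval_graphs a b ->
  ~~ covered E a /\ ~~ covered E b.
Proof.
move=> /interval_graphsP[_ /supportedP sE _ _].
by split; apply/coveredP => -[u [v [? ? /sE]]]; lia.
Qed.

(** The condition makes [c] the first inner uncovered vertex. Cutting there splits off a block and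
    leaves a graph with one inner uncovered vertex fewer. *)
Lemma card_first_uncovered a b c d : a < c < b -> b < m ->
  #|[set E in degree_graphs a b d.+1 | ~~ covered E c && (degree E a c == 0)]|
    = #|degree_graphs a c 0| * #|degree_graphs c b d|.
Proof.
move=> acb bm.
apply: (@card_setX_bij _ _ _ _ _ _ (fun E => restrict E a c)
  (fun E => restrict E c b) (fun E1 E2 => E1 :|: E2)).
  move=> E; rewrite inE mem_degree_graphs.
  move=> /andP[/andP[GE /eqP dE] /andP[cc /eqP dc]].
  have [ca cb] := boundary_uncovered GE; rewrite !mem_degree_graphs.
  rewrite (restrict_left GE) ?(restrict_right GE) ?(degree_restrict GE) //; try lia.
  rewrite dc; split=> //; last exact: interval_graphs_split GE cc.
  move: dE; rewrite (degree_split acb) // dc; lia.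
move=> E1 E2; rewrite !mem_degree_graphs => /andP[G1 /eqP d1] /andP[G2 /eqP d2].
rewrite (restrictUl _ G1 G2) // (restrictUr _ G1 G2) //.
have cc := uncoveredU G1 G2.
have GE : E1 :|: E2 \in interval_graphs a b by apply: interval_graphsU G1 G2; lia.
have [ca cb] := boundary_uncovered GE.
rewrite inE mem_degree_graphs GE cc (degree_split acb) //.
rewrite -(degree_restrict GE (a' := a) (b' := c)) //; try lia.
rewrite -(degree_restrict GE (a' := c) (b' := b)) //; try lia.
by rewrite (restrictUl _ G1 G2) // (restrictUr _ G1 G2) // d1 d2 !eqxx.
Qed.

(** The sum runs over the position [a + k] of the first inner uncovered vertex, which exists because
    the degree is positive. *)
Lemma card_degreeS a n d : a + n < m ->
  #|degree_graphs a (a + n) d.+1| =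
    \sum_(k < n | 0 < k)
       #|degree_graphs a (a + k) 0| * #|degree_graphs (a + k) (a + n) d|.
Proof.
move=> nm; rewrite (card_exists_unique (Q := fun k : 'I_n => 0 < k)
  (P := fun k E => ~~ covered E (a + k) && (degree E a (a + k) == 0))).
- apply: eq_bigr => k k0; apply: card_first_uncovered => //.
  by have := ltn_ord k; lia.
- move=> E; rewrite mem_degree_graphs => /andP[_ /eqP dE].
  have : [exists k : 'I_m, (a < k < a + n) && ~~ covered E k].
    have /card_gt0P[k] : 0 < degree E a (a + n) by rewrite dE.
    by rewrite inE => ?; apply/existsP; exists k.
  move=> /existsP[k0 k0P].
  have ex : exists k, (a < k < a + n) && ~~ covered E k by exists k0.
  case: (ex_minnP ex) => k /andP[akn ck] kmin.
  have kn : k - a < n by lia.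
  exists (Ordinal kn) => /=; first by lia.
  rewrite subnKC; last by lia.
  rewrite ck cards_eq0; apply/eqP/setP => j; rewrite !inE.
  apply/negP => /andP[aj cj]; have := kmin j; rewrite cj; lia.
move=> E c c' _ c0 c'0 /andP[uc dc] /andP[uc' dc'].
(* If [k < l], the uncovered vertex [a + k] would be counted in [degree E a (a + l)]. *)
have H (k l : 'I_n) : 0 < k -> ~~ covered E (a + k) ->
    degree E a (a + l) == 0 -> l <= k.
  move=> k0 ck; rewrite leqNgt cards_eq0 => /eqP/setP dl; apply/negP => kl.
  have km : a + k < m by have := ltn_ord k; lia.
  by have := dl (Ordinal km); rewrite !inE /= ck; lia.
by apply: val_inj; apply/eqP; rewrite eqn_leq !H.
Qed.

Lemma connect_closed E (S : pred 'I_m) u v :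
  (forall x y, adjacent E x y -> S x -> S y) ->
  connect (adjacent E) u v -> S u -> S v.
Proof.
move=> clS /connectP[s]; elim: s u => [|w s IHs] u /=; first by move=> _ ->.
by move=> /andP[uw ws] vs Su; apply: IHs ws vs _; exact: clS uw Su.
Qed.

Lemma interval_graphs_refl a : a < m ->
  interval_graphs a a = [set set0 : {set {set 'I_m}}].
Proof.
move=> am; apply/setP => E; rewrite in_set1.
apply/interval_graphsP/eqP => [[gE /supportedP sE _ _]|->].
  apply: graph_eq => // [|u v uv]; first by apply/forall_inP => e; rewrite inE.
  rewrite [RHS]/adjacent inE; apply/negP => /sE; lia.
split.
- by apply/forall_inP => e; rewrite inE.
- by apply/supportedP => u v; rewrite /adjacent inE.
- by apply/noncrossingP => u v w z _ _ _; rewrite /adjacent inE.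
- apply/connected_onP => u v ua va; rewrite (_ : u = v) //; apply: val_inj => /=; lia.
Qed.

Lemma degree_refl E a : degree E a a = 0.
Proof.
apply/eqP; rewrite cards_eq0; apply/eqP/setP => k; rewrite !inE.
by case: ltngtP.
Qed.

Lemma card_degree_refl a d : a < m -> #|degree_graphs a a d| = (d == 0).
Proof.
move=> am; rewrite /degree_graphs interval_graphs_refl //.
have [->|d0] := eqVneq d 0.
  rewrite (_ : finset _ = [set set0]) ?cards1 //.
  by apply/setP => E; rewrite !inE degree_refl eqxx andbT.
apply/eqP; rewrite cards_eq0; apply/eqP/setP => E.
by rewrite !inE degree_refl [0 == d]eq_sym (negPf d0) andbF.
Qed.

Lemma degree_lt E a b : a < m -> degree E a b < m.
Proof.
move=> am; rewrite -[X in _ < X]card_ord -cardsT.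
apply: proper_card; rewrite properT; apply/eqP => /setP/(_ (Ordinal am)).
by rewrite !inE ltnn.
Qed.

(** The free bound [M] lets counts for different [m] be written as sums with the same range. *)
Lemma card_interval_graphs a b M : a < m -> m <= M ->
  #|interval_graphs a b : {set {set {set 'I_m}}}|
    = \sum_(d < M) #|degree_graphs a b d|.
Proof.
move=> am mM.
rewrite (card_exists_unique (Q := xpredT)
  (P := fun (d : 'I_M) E => degree E a b == d)) //.
  move=> E _; exists (Ordinal (leq_trans (degree_lt E b am) mM)) => //.
by move=> E c c' _ _ _ /eqP-> /eqP/val_inj.
Qed.

(* The farthest neighbour v of va must be vb: an edge covering v would either
   start at va or cross the edge from va to v. *)
Lemma degree0_adjacent E (va vb : 'I_m) : va < vb ->
  E \in interval_graphs va vb -> (degree E va vb == 0) = adjacent E va vb.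
Proof.
move=> ab /interval_graphsP[gE /supportedP sE /noncrossingP nE /connected_onP cE].
rewrite cards_eq0; apply/eqP/idP => [/setP d0|Eab]; last first.
  apply/setP => k; rewrite !inE; apply/negP => /andP[/andP[ak kb] /coveredP[]].
  by exists va, vb.
have [v0 Ev0] : exists v, adjacent E va v.
  have /connectP[[|v s] /=] := cE va vb ltac:(lia) ltac:(lia).
    by move=> _ eba; rewrite eba ltnn in ab.
  by move=> /andP[Ev _] _; exists v.
case: (arg_maxnP (fun v : 'I_m => val v) Ev0) => v /= Ev vmax.
have [_ vb1] := sE _ _ Ev; have /eqP := adjacent_neq gE Ev => va_neq.
have [vlt|] := ltnP v vb; last first.
  by move=> bv; rewrite (_ : vb = v) //; apply: val_inj => /=; lia.
have av : va < v.
  by rewrite ltn_neqAle; apply/andP; split; [apply/eqP => /val_inj|lia].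
have := d0 v; rewrite !inE av vlt /= => /negbFE/coveredP[u [w [uv vw Euw]]].
have [uE _] := sE _ _ Euw.
have [ua|ua|/val_inj ua] := ltngtP va u; [|lia|].
  by case: (nE va v u w).
by have := vmax w; rewrite /= ua Euw => /(_ isT); lia.
Qed.

(** * Deleting the outer edge *)

Lemma adjacentD1 E u v w z : u < v -> w < z ->
  adjacent (E :\ [set w; z]) u v = ~~ ((u == w) && (v == z)) && adjacent E u v.
Proof. by move=> uv wz; rewrite /adjacent in_setD1 eq_pair. Qed.

(** The gap is the one between [c] and [c.+1]. If it is free, the vertices up to [c] and those after
    it are both closed under adjacency. *)
Definition free_gap E c :=
  [forall u : 'I_m, forall v : 'I_m, adjacent E u v ==> ~~ (u <= c < v)].

Lemma free_gapP E c :
  reflect (forall u v, adjacent E u v -> u <= c -> v <= c) (free_gap E c).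
Proof.
apply: (iffP idP) => [/'forall_'forall_implyP H u v uv uc|H].
  by have := H u v uv; rewrite uc /= -leqNgt.
apply/'forall_'forall_implyP => u v uv; apply/negP => /andP[uc].
by have := H _ _ uv uc; lia.
Qed.

Lemma adjacentW E u v w z : adjacent (E :\ [set w; z]) u v -> adjacent E u v.
Proof. by rewrite /adjacent in_setD1 => /andP[]. Qed.

(* If va is separated from vb and c is the last vertex reachable from va, then
   an edge passing over the gap after c crosses a path from va to c. *)
Lemma delete_edge E (va vb : 'I_m) : va < vb -> E \in interval_graphs va vb ->
  (E :\ [set va; vb] \in interval_graphs va vb) ||
  [exists c : 'I_m, (va <= c < vb) && free_gap (E :\ [set va; vb]) c].
Proof.
move=> ab /interval_graphsP[gE /supportedP sE /noncrossingP nE /connected_onP cE].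
set E' := E :\ _.
have [cab|ncab] := boolP (connect (adjacent E') va vb).
  apply/orP; left; apply/interval_graphsP; split.
  - exact: is_graph_sub (subD1set _ _) gE.
  - by apply/supportedP => u v /adjacentW/sE.
  - by apply: (sub_noncrossing (subD1set _ _)); apply/noncrossingP.
  apply/connected_onP => u v ua vb'; apply: (connect_sub _ (cE _ _ ua vb')).
  (* Where a path of [E] uses the deleted edge, [cab] supplies a detour. *)
  have step (x y : 'I_m) : x < y -> adjacent E x y -> connect (adjacent E') x y.
    move=> xy Exy; case: (boolP ((x == va) && (y == vb))).
      by move=> /andP[/eqP-> /eqP->].
    by move=> ne; apply: connect1; rewrite adjacentD1 // ne.
  move=> x y; have [xy|yx|/val_inj->] := ltngtP x y; first exact: step.
    by rewrite adjacentC connect_adjacentC; exact: step.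
  by move=> _; exact: connect0.
apply/orP; right.
case: (arg_maxnP (fun v : 'I_m => val v) (connect0 (adjacent E') va)) => c /= cA cmax.
have sA k : connect (adjacent E') va k -> va <= k <= vb.
  move=> H; apply: (connect_closed (S := fun k : 'I_m => va <= k <= vb) _ H).
    by move=> x y /adjacentW/sE[].
  by rewrite leqnn ltnW.
have cb : c < vb.
  have := sA _ cA; rewrite (leq_eqVlt c) => /andP[_ /orP[/eqP/val_inj cb|//]].
  by rewrite -cb cA in ncab.
apply/existsP; exists c; rewrite cb; have /andP[-> _] := sA _ cA.
apply/free_gapP => u v Euv uc; rewrite leqNgt; apply/negP => cv.
have uA : ~~ connect (adjacent E') va u.
  apply/negP => uA; have /= := cmax v (connect_trans uA (connect1 Euv)); lia.
have [uE vE] := sE _ _ (adjacentW Euv).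
have au : va < u.
  rewrite ltn_neqAle; apply/andP; split; last by lia.
  by apply: contraNneq uA => /val_inj ->; exact: connect0.
(* The vertices below [u] reachable from [va] form a closed set: a step over [u] ends at most at
   [c < v], hence crosses the edge from [u] to [v]. So [c < u], against [uc]. *)
suff : connect (adjacent E') va c && (c < u) by lia.
apply: (connect_closed (S := fun k : 'I_m => connect (adjacent E') va k && (k < u)) _ cA);
  last by rewrite connect0 au.
move=> x y Exy /andP[xA xu].
have yA := connect_trans xA (connect1 Exy); rewrite yA /=.
have /= yc := cmax _ yA.
have [//|uy|/val_inj yu] := ltngtP y u; last by rewrite yu in yA; rewrite yA in uA.
by case: (nE x y u v) => //; [lia|exact: adjacentW Exy|exact: adjacentW Euv].
Qed.

Lemma free_disconnected E a b c : a <= c < b -> b < m ->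
  E \in interval_graphs a b -> ~~ free_gap E c.
Proof.
move=> acb bm /interval_graphsP[_ _ _ /connected_onP cE]; apply/negP => /free_gapP fc.
have am : a < m by lia.
have ca : connect (adjacent E) (Ordinal am) (Ordinal bm) by apply: cE => /=; lia.
by have := connect_closed (S := fun k => k <= c) fc ca => /=; lia.
Qed.

(** Between two free gaps the vertices from [c.+1] to [c'] would be cut off even in [E], since the
    outer edge touches none of them. *)
Lemma free_unique E (va vb : 'I_m) c c' : va <= c < vb -> va <= c' < vb ->
  E \in interval_graphs va vb ->
  free_gap (E :\ [set va; vb]) c -> free_gap (E :\ [set va; vb]) c' -> c = c'.
Proof.
wlog cc : c c' / c < c'.
  move=> H ac ac' GE fc fc'; have [cc|cc|//] := ltngtP c c'; first exact: H.
  by symmetry; apply: H.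
move=> acb acb' /interval_graphsP[gE _ _ /connected_onP cE] /free_gapP fc /free_gapP fc'.
have cm : c.+1 < m by have := ltn_ord vb; lia.
have ca : connect (adjacent E) (Ordinal cm) va by apply: cE => /=; lia.
have := connect_closed (S := fun k => c < k <= c') _ ca => /=.
suff H : forall x y, adjacent E x y -> c < x <= c' -> c < y <= c' by move=> /(_ H); lia.
move=> x y Exy xc.
have E'xy : adjacent (E :\ [set va; vb]) x y.
  rewrite /adjacent in_setD1 -/(adjacent E x y) Exy andbT.
  apply/eqP => /setP/(_ x); rewrite !inE eqxx /=
    => /esym/orP[]/eqP ex; move: xc; rewrite ex; lia.
have := fc' _ _ E'xy; move: E'xy; rewrite adjacentC => /fc; lia.
Qed.

(** Only the outer edge crosses the gap. Sending all vertices after [c] to [va] contracts it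
    together with everything on the right. *)
Lemma restrict_free_left E (va vb : 'I_m) c : va <= c < vb ->
  E \in interval_graphs va vb -> free_gap (E :\ [set va; vb]) c ->
  restrict E va c \in interval_graphs va c.
Proof.
move=> acb GE /free_gapP fc.
have /interval_graphsP[_ /supportedP sE _ _] := GE.
apply: (restrict_interval_graphs
          (r := fun u => if u <= c then u else va)) GE _ _ _ _; try lia.
  by move=> u /andP[_ ->].
move=> u v uv Euv; have [su sv] := sE _ _ Euv.
have [vc|cv] := leqP v c; first by right; lia.
left; have := fc u v; rewrite adjacentD1; try lia.
rewrite Euv andbT; case: (boolP (_ && _)) => [/andP[/eqP-> _] _|_ /(_ isT) uc].
  by rewrite if_same.
by case: ifP => // uc'; have := uc uc'; lia.
Qed.

Lemma restrict_free_right E (va vb : 'I_m) c : va <= c < vb ->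
  E \in interval_graphs va vb -> free_gap (E :\ [set va; vb]) c ->
  restrict E c.+1 vb \in interval_graphs c.+1 vb.
Proof.
move=> acb GE /free_gapP fc.
have /interval_graphsP[_ /supportedP sE _ _] := GE.
apply: (restrict_interval_graphs
          (r := fun u => if c < u then u else vb)) GE _ _ _ _; try lia.
  by move=> u /andP[-> _].
move=> u v uv Euv; have [su sv] := sE _ _ Euv.
have [uc|cu] := leqP u c; last by right; lia.
left; have := fc u v; rewrite adjacentD1; try lia.
rewrite Euv andbT; case: (boolP (_ && _)) => [/andP[_ /eqP->] _|_ /(_ isT uc) vc].
  by rewrite if_same.
by case: ifP => //; lia.
Qed.

Lemma restrictU1 E (va vb : 'I_m) a b : ~~ ((a <= va <= b) && (a <= vb <= b)) ->
  restrict ([set va; vb] |: E) a b = restrict E a b.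
Proof.
move=> ne; apply/setP => e; rewrite !inE; case: eqVneq => //= ->.
suff -> : [forall k in [set va; vb], a <= val k <= b] = false by rewrite andbF.
apply/negbTE; apply: contraNN ne => /forall_inP H.
by rewrite !H // !inE eqxx ?orbT.
Qed.

Lemma supported_outer E (va vb : 'I_m) : va < vb -> supported E va vb ->
  supported ([set va; vb] |: E) va vb.
Proof.
move=> ab /supportedP sE; apply/'forall_'forall_implyP => u v.
rewrite adjacentU {1}/adjacent in_set1 => /orP[/eqP/setP/(_ u)|/sE[]//].
by rewrite !inE eqxx => /esym/orP[]/eqP->; rewrite leqnn ltnW.
Qed.

(** The outer edge joins the extreme labels, so it alternates with no edge. *)
Lemma noncrossing_outer E (va vb : 'I_m) : va < vb -> supported E va vb ->
  noncrossing E -> noncrossing ([set va; vb] |: E).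
Proof.
move=> ab sE /noncrossingP nE; have /supportedP sE' := supported_outer ab sE.
apply/noncrossingP => u v w z uw wv vz Euv Ewz.
have [/andP[au _] _] := sE' _ _ Euv; have [_ /andP[_ zb]] := sE' _ _ Ewz.
have uv := ltn_trans uw wv; have wz := ltn_trans wv vz.
move: Euv Ewz; rewrite !adjacentU {1 3}/adjacent !in_set1 !eq_pair // => /orP[|Euv].
  by move=> /andP[_ /eqP vb']; rewrite vb' ltnNge zb in vz.
move=> /orP[/andP[/eqP wa _]|]; last exact: nE Euv.
by rewrite wa ltnNge au in uw.
Qed.

(** Such a graph consists of two connected graphs on adjacent intervals, joined by the outer edge
    alone. *)
Lemma card_free (va vb : 'I_m) c : va <= c < vb ->
  #|[set E in interval_graphs va vb |
        adjacent E va vb && free_gap (E :\ [set va; vb]) c]|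
    = #|interval_graphs va c : {set {set {set 'I_m}}}|
      * #|interval_graphs c.+1 vb : {set {set {set 'I_m}}}|.
Proof.
move=> acb; have ab : va < vb by lia.
apply: (@card_setX_bij _ _ _ _ _ _ (fun E => restrict E va c)
  (fun E => restrict E c.+1 vb) (fun E1 E2 => [set va; vb] |: (E1 :|: E2))).
  move=> E; rewrite inE => /and3P[GE Eab fc].
  rewrite (restrict_free_left acb GE fc) (restrict_free_right acb GE fc); split=> //.
  have /interval_graphsP[gE /supportedP sE _ _] := GE.
  apply: graph_eq => //.
    by apply: is_graphU; [exact: is_graph1|apply: is_graphU; exact: is_graph_restrict].
  move=> u v uv; rewrite !adjacentU !adjacent_restrict.
  rewrite {1}/adjacent in_set1 eq_pair //.
  case: (boolP (_ && _)) => [/andP[/eqP-> /eqP->]|ne] /=; first by rewrite Eab.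
  case Euv: (adjacent E u v) => //=.
  have := free_gapP _ _ fc u v; rewrite adjacentD1 // ne Euv => /(_ isT).
  have := sE _ _ Euv; lia.
move=> E1 E2 G1 G2; rewrite inE !restrictU1; try lia.
rewrite (restrictUl _ G1 G2) // (restrictUr _ G1 G2) //.
have /interval_graphsP[g1 /supportedP s1 _ /connected_onP c1] := G1.
have /interval_graphsP[g2 /supportedP s2 _ /connected_onP c2] := G2.
have abE : [set va; vb] \notin E1 :|: E2.
  apply/negP; rewrite -/(adjacent _ va vb) adjacentU => /orP[/s1|/s2]; lia.
rewrite setU1K // /adjacent setU11; split=> //=; apply/andP; split; last first.
  by apply/free_gapP => u v; rewrite adjacentU => /orP[/s1|/s2]; lia.
have sE : supported (E1 :|: E2) va vb.
  by apply/supportedP => u v; rewrite adjacentU => /orP[/s1|/s2]; lia.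
apply/interval_graphsP; split.
- by apply: is_graphU; [exact: is_graph1|exact: is_graphU].
- exact: supported_outer.
- by apply: noncrossing_outer => //; exact: noncrossingU (leqnSn c) G1 G2.
have cab : connect (adjacent ([set va; vb] |: (E1 :|: E2))) vb va.
  by apply: connect1; rewrite adjacentC /adjacent setU11.
apply: (@connected_on_root _ _ _ va) => u ub.
have [uc|cu] := leqP u c; first by apply/connectUr/connectUl/c1; lia.
by apply: connect_trans cab; apply/connectUr/connectUr/c2; lia.
Qed.

End Graphs.

(** * Recurrences for the counts and translation invariance *)

Lemma card_degree0 m a n : 0 < n -> a + n < m ->
  #|degree_graphs m a (a + n) 0| + #|degree_graphs m a (a + n) 0|
    = #|interval_graphs m a (a + n)|
      + \sum_(k < n) #|interval_graphs m a (a + k)|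
                     * #|interval_graphs m (a + k).+1 (a + n)|.
Proof.
move=> n0 bm; have am : a < m by lia.
pose va := Ordinal am; pose vb := Ordinal bm.
have ab : va < vb by rewrite /=; lia.
pose G := interval_graphs m va vb.
pose e := [set va; vb].
pose D := [set E in G | adjacent E va vb].
have D0 : degree_graphs m a (a + n) 0 = D.
  apply/setP => E; rewrite mem_degree_graphs [RHS]inE.
  rewrite -[interval_graphs _ _ _]/G; case GE: (E \in G) => //=.
  by rewrite -(degree0_adjacent ab GE).
(* Adding [e] back inverts its deletion on the blocks that stay connected. *)
have Dk : #|[set E in D | E :\ e \in G]| = #|[set E in G | ~~ adjacent E va vb]|.
  rewrite -(card_in_imset (f := fun E => E :\ e)).
    apply: eq_card => E; apply/imsetP/idP => [[E0]|].
      rewrite !in_set => /andP[_ GE] ->; rewrite GE /= /adjacent.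
      by rewrite in_setD1 eqxx.
    rewrite !in_set => /andP[GE nab]; exists (e |: E); last by rewrite setU1K.
    rewrite !in_set setU1K // GE /adjacent setU11 !andbT.
    have /interval_graphsP[gE sE nE /connected_onP cE] := GE.
    apply/interval_graphsP; split.
    - by apply: is_graphU => //; exact: is_graph1.
    - exact: supported_outer.
    - exact: noncrossing_outer.
    - by apply/connected_onP => u v ua vb'; apply: connectUr; exact: cE.
  move=> E E'; rewrite !in_set => /andP[/andP[_ ab1] _] /andP[/andP[_ ab2] _] H.
  by rewrite -(setD1K ab1) -(setD1K ab2) -/e H.
(* Only one of the two copies of [D] is split. Its part that stays connected has as many elements as
   there are graphs without [e], and these complete the other copy to [G]. *)
rewrite D0 -{2}(cardsID [set E | E :\ e \in G] D) addnA.
have -> : D :&: [set E | E :\ e \in G] = [set E in D | E :\ e \in G].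
  by apply/setP => E; rewrite !in_set.
rewrite Dk -[#|interval_graphs m a (a + n)|](cardsID [set E | adjacent E va vb]).
have -> : G :&: [set E | adjacent E va vb] = D by apply/setP => E; rewrite !in_set.
congr (_ + _ + _); first by apply: eq_card => E; rewrite !in_set andbC.
(* The blocks disconnected by the deletion are sorted by their unique free gap. *)
rewrite (card_exists_unique (Q := xpredT)
  (P := fun (k : 'I_n) E => free_gap (E :\ e) (a + k))).
- apply: eq_bigr => k _.
  have kn : va <= a + k < vb by have := ltn_ord k; rewrite /=; lia.
  rewrite -(card_free kn); apply: eq_card => E; rewrite !in_set.
  apply/andP/and3P => [[/and3P[_ GE Eab] fE]|[GE Eab fE]] //.
  split=> //; rewrite GE Eab !andbT; apply/negP => /(free_disconnected kn).
  by rewrite fE => /(_ bm).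
- move=> E; rewrite !in_set => /and3P[nG GE Eab].
  have := delete_edge ab GE; rewrite (negPf nG) /= => /existsP[c /andP[acb fc]].
  have cn : c - a < n by lia.
  by exists (Ordinal cn); rewrite //= subnKC //; lia.
- move=> E k l; rewrite !in_set => /and3P[_ GE _] _ _ fk fl; apply/val_inj/eqP.
  rewrite -(eqn_add2l a); apply/eqP; apply: (free_unique _ _ GE fk fl).
    by have := ltn_ord k; rewrite /=; lia.
  by have := ltn_ord l; rewrite /=; lia.
Qed.

(** By strong induction on [n], positive degrees reduce to shorter intervals. In [card_degree0] the
    unknown count of degree 0 occurs twice on the left and once in the total on the right, so it is
    determined. *)
Lemma card_degree_translate n m a m' a' d : a + n < m -> a' + n < m' ->
  #|degree_graphs m a (a + n) d| = #|degree_graphs m' a' (a' + n) d|.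
Proof.
elim/ltn_ind: n m a m' a' d => n IHn m a m' a' d nm nm'.
have [n0|n_gt0] := posnP n.
  by rewrite n0 !addn0 !card_degree_refl //; lia.
have IHS e : #|degree_graphs m a (a + n) e.+1|
    = #|degree_graphs m' a' (a' + n) e.+1|.
  rewrite !card_degreeS //; apply: eq_bigr => k k0.
  have kn := ltn_ord k; congr (_ * _).
    by apply: IHn; lia.
  have -> : a + n = a + k + (n - k) by lia.
  have -> : a' + n = a' + k + (n - k) by lia.
  by apply: IHn; lia.
case: d => [|e]; last exact: IHS.
have IHG b l c : b + l < m -> c + l < m' -> l < n ->
    #|interval_graphs m b (b + l)| = #|interval_graphs m' c (c + l)|.
  move=> lm lm' ln.
  rewrite !(@card_interval_graphs _ _ _ (m + m')) ?leq_addr ?leq_addl; try lia.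
  by apply: eq_bigr => i _; apply: IHn.
have sumE : \sum_(k < n) #|interval_graphs m a (a + k)|
              * #|interval_graphs m (a + k).+1 (a + n)|
          = \sum_(k < n) #|interval_graphs m' a' (a' + k)|
              * #|interval_graphs m' (a' + k).+1 (a' + n)|.
  apply: eq_bigr => k _; have kn := ltn_ord k; congr (_ * _).
    by apply: IHG; lia.
  have -> : a + n = (a + k).+1 + (n - k.+1) by lia.
  have -> : a' + n = (a' + k).+1 + (n - k.+1) by lia.
  by apply: IHG; lia.
have := card_degree0 n_gt0 nm; have := card_degree0 n_gt0 nm'.
rewrite sumE !(@card_interval_graphs _ _ _ (m + m').+1) ?leqW ?leq_addr ?leq_addl; try lia.
have sumS : \sum_(i < m + m') #|degree_graphs m a (a + n) (lift ord0 i)|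
    = \sum_(i < m + m') #|degree_graphs m' a' (a' + n) (lift ord0 i)|.
  by apply: eq_bigr => i _; exact: IHS.
by rewrite !big_ord_recl sumS /=; lia.
Qed.

(* By [card_degree_translate] the counts depend only on the length n of the
   interval; n edges of the convex chain carry n.+1 vertices. *)
Definition graph_number n d := #|degree_graphs n.+1 0 n d|.

Lemma graph_numberE m a n d : a + n < m ->
  #|degree_graphs m a (a + n) d| = graph_number n d.
Proof. by move=> nm; apply: (@card_degree_translate n m a n.+1 0). Qed.

Lemma graph_number0 d : graph_number 0 d = (d == 0).
Proof. exact: card_degree_refl. Qed.

Lemma graph_numberS n d : graph_number n d.+1
  = \sum_(k < n | 0 < k) graph_number k 0 * graph_number (n - k) d.
Proof.
rewrite {1}/graph_number -{3}[n]add0n card_degreeS //.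
apply: eq_bigr => k k0; have kn := ltn_ord k.
rewrite graph_numberE; last by lia.
by rewrite [X in degree_graphs _ _ X _](_ : _ = 0 + k + (n - k)) ?graph_numberE //; lia.
Qed.

Lemma graph_number_gt n d : n < d -> graph_number n d = 0.
Proof.
move=> nd; apply/eqP; rewrite cards_eq0; apply/eqP/setP => E.
rewrite mem_degree_graphs inE; apply/negP => /andP[_ /eqP dE].
by have := degree_lt E n (ltn0Sn n); rewrite dE; lia.
Qed.

(** By [graph_number_gt] no larger degree occurs, so this counts all graphs of length [n]. *)
Definition total_number n := \sum_(d < n.+1) graph_number n d.

Lemma total_numberE m a n M : a + n < m -> n < M -> 
  \sum_(d < M) graph_number n d = #|interval_graphs m a (a + n)|.
Proof.
move=> nm nM; rewrite (@card_interval_graphs _ _ _ (M + m)) ?leq_addl //; last by lia.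
rewrite (eq_bigr _ (fun (d : 'I_(M + m)) _ => graph_numberE _ nm)).
rewrite big_split_ord /= [X in _ = _ + X]big1 ?addn0 // => i _.
by rewrite graph_number_gt //; lia.
Qed.

Lemma graph_number_double n : 0 < n -> graph_number n 0 + graph_number n 0
  = total_number n + \sum_(k < n) total_number k * total_number (n - k.+1).
Proof.
move=> n0; have := @card_degree0 n.+1 0 n n0 (leqnn _).
rewrite -/(graph_number n 0) => ->; congr (_ + _).
  by rewrite -(@total_numberE n.+1 0 n n.+1) // add0n.
apply: eq_bigr => k _; have kn := ltn_ord k; congr (_ * _).
  by rewrite -(@total_numberE n.+1 0 k k.+1) //; lia.
have -> : 0 + n = (0 + k).+1 + (n - k.+1) by lia.
by rewrite -(@total_numberE _ _ _ (n - k.+1).+1) //; lia.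
Qed.

(** * Generating function of blocks *)

Section GeneratingFunction.
Local Open Scope ring_scope.
Variable N : nat.

(** Congruence modulo the power [N.+1] of ['X]: truncated polynomials stand in for power series. *)
Let eqN (P Q : {poly int}) := forall n, (n <= N)%N -> P`_n = Q`_n.

Let eqN_mull P Q R : eqN P Q -> eqN (R * P) (R * Q).
Proof.
move=> PQ n nN; rewrite !coefM; apply: eq_bigr => i _; congr (_ * _).
by apply: PQ; have := ltn_ord i; lia.
Qed.

(* The coefficient at 0 vanishes although [graph_number 0 0 = 1]: a single
   vertex is not a block. *)
Definition block_poly : {poly int} :=
  \poly_(k < N.+1) (if k == 0 then 0 else (graph_number k 0)%:Z).
Local Notation B := block_poly.

Lemma coef_block n : (n <= N)%N ->
  B`_n = if n == 0 then 0 else (graph_number n 0)%:Z.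
Proof. by move=> nN; rewrite coef_poly ltnS nN. Qed.

(** A graph of degree [d] is a chain of [d.+1] blocks; [graph_numberS] is the Cauchy product with
    one further block. *)
Lemma coef_block_exp n d : (n <= N)%N ->
  (B ^+ d.+1)`_n = if n == 0 then 0 else (graph_number n d)%:Z.
Proof.
elim: d n => [|d IHd] n nN; first by rewrite expr1 coef_block.
rewrite exprS coefM.
have [->|n0] := eqVneq n 0.
  by rewrite big_ord1 coef_block // mul0r.
rewrite graph_numberS big_ord_recr /= subnn IHd // mulr0 addr0.
rewrite (big_morph Posz PoszD (erefl 0%:Z)) [RHS]big_mkcond /=.
apply: eq_bigr => k _; have kn := ltn_ord k.
rewrite IHd; last by lia.
rewrite coef_block; last by lia.
rewrite subn_eq0 leqNgt kn /= lt0n.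
by case: eqVneq => /= _; rewrite ?mul0r // PoszM.
Qed.

(** [B ^+ N.+2] counts graphs of degree [N.+1], which [graph_number_gt] excludes for lengths up to
    [N]. *)
Let M := N.+2.

Lemma block_exp_nilp : eqN (B ^+ M) 0.
Proof.
move=> n nN; by rewrite coef_block_exp // coef0 graph_number_gt // if_same.
Qed.

(** The truncated series of [1 / (1 - B)]; its term [d = 0] is the single vertex. *)
Definition total_poly : {poly int} := \sum_(d < M) B ^+ d.
Local Notation C := total_poly.

Lemma coef_total n : (n <= N)%N -> C`_n = (total_number n)%:Z.
Proof.
move=> nN; rewrite coef_sum big_ord_recl expr0 coef1.
under eq_bigr => d _ do rewrite lift0 coef_block_exp //.
have [->|n0] := eqVneq n 0.
  by rewrite big1 // /total_number big_ord1 graph_number0.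
rewrite add0r -(big_morph Posz PoszD (erefl 0%:Z)).
by rewrite (@total_numberE n.+1 0) // -(@total_numberE n.+1 0 n n.+1).
Qed.

Lemma total_geometric : eqN (C * (1 - B)) 1.
Proof.
move=> n nN; have -> : C * (1 - B) = 1 - B ^+ M.
  by rewrite -(opprB (B ^+ M)) subrX1 -/C; ring.
by rewrite coefB block_exp_nilp // coef0 subr0.
Qed.

(** At positive lengths this is [graph_number_double], with ['X] for the gap between the two
    intervals. The [- 1] removes the single vertex at length 0. *)
Lemma block_double : eqN (B *+ 2) (C - 1 + 'X * C * C).
Proof.
move=> n nN; rewrite coefMn !coefD coefN coef1 coef_block // coef_total //.
rewrite -mulrA coefXM.
have [->|n0] := eqVneq n 0; first by rewrite /total_number big_ord1 graph_number0.
rewrite subr0 mulr2n -PoszD graph_number_double ?lt0n // PoszD; congr (_ + _).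
rewrite (big_morph Posz PoszD (erefl 0%:Z)) coefM prednK ?lt0n //.
apply: eq_bigr => k _; have kn := ltn_ord k.
rewrite !coef_total; try lia.
by rewrite PoszM; congr (_ * (total_number _)%:Z); lia.
Qed.

(** Multiply [block_double] by [1 - B] and replace [C * (1 - B)] by 1. *)
Lemma block_equation : eqN (B * (1 - B *+ 2)) ('X * C).
Proof.
have e1 := eqN_mull (1 - B) block_double.
have e2 := eqN_mull ('X * C + 1) total_geometric.
move=> n nN; have := e1 n nN; have := e2 n nN.
have -> : (1 - B) * (B *+ 2) = B * (1 - B *+ 2) + B by ring.
have -> : (1 - B) * (C - 1 + 'X * C * C) = ('X * C + 1) * (C * (1 - B)) - (1 - B).
  by ring.
rewrite mulr1 coefD coefB coefD => -> /(canRL (addrK _)) ->.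
rewrite !coefD !coefN; ring.
Qed.

(** The truncated series of [1 / ((1 - B) * (1 - 2 * B))]. *)
Definition weight_poly : {poly int} := \sum_(q < M) (2 ^+ q.+1 - 1) * B ^+ q.
Local Notation D := weight_poly.

(** Since [(2 ^+ q.+1 - 1) - 2 * (2 ^+ q - 1) = 1], the product has the coefficients of [C] up to
    one term at the top. *)
Lemma weight_telescope : D * (1 - B *+ 2) = C - (2 ^+ M.+1 - 2) * B ^+ M.
Proof.
rewrite /D /C; elim: M => [|k IHk]; first by rewrite !big_ord0 expr1; ring.
by rewrite !big_ord_recr /= mulrDl IHk !exprS; ring.
Qed.

(** Multiply [block_equation] by the truncated inverse [P] of [1 - 2 * B] and express [C] through
    [D]; all errors are multiples of [B ^+ M]. *)
Lemma block_weight : eqN B ('X * D).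
Proof.
pose P : {poly int} := \sum_(j < M) (2 * B) ^+ j.
have PE : P * (1 - B *+ 2) = 1 - 2 ^+ M * B ^+ M.
  have := subrX1 (2 * B) M; rewrite -/P exprMn => e.
  by rewrite -[RHS]opprB e; ring.
have nilp R : eqN (R * B ^+ M) 0.
  by move=> n nN; rewrite (eqN_mull R block_exp_nilp nN) mulr0.
move=> n nN.
have -> : B = P * (B * (1 - B *+ 2)) + (B * 2 ^+ M) * B ^+ M.
  by rewrite mulrCA PE; ring.
rewrite coefD (nilp _ n nN) coef0 addr0 (eqN_mull P block_equation nN).
have -> : P * ('X * C)
    = 'X * D * (P * (1 - B *+ 2)) + (P * 'X * (2 ^+ M.+1 - 2)) * B ^+ M.
  have -> : C = D * (1 - B *+ 2) + (2 ^+ M.+1 - 2) * B ^+ M.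
    by rewrite weight_telescope; ring.
  ring.
rewrite PE coefD (nilp _ n nN) coef0 addr0 mulrBr mulr1 coefB mulrA.
by rewrite (nilp _ n nN) coef0 subr0.
Qed.

(** One factor of [B ^+ p.+1] is replaced by ['X * D]; the ['X] lowers the length to [n]. *)
Lemma graph_number_weight n p : (n < N)%N -> (graph_number n.+1 p)%:Z
  = \sum_(q < M) (2 ^+ q.+1 - 1) * (B ^+ (p + q))`_n.
Proof.
move=> nN; have := coef_block_exp p nN; rewrite /= => <-.
rewrite exprSr (eqN_mull _ block_weight nN) mulrCA coefXM /= mulr_sumr coef_sum.
apply: eq_bigr => q _; rewrite mulrCA -exprD.
have -> : 2 ^+ q.+1 - 1 = (2 ^+ q.+1 - 1)%:P :> {poly int}.
  by rewrite rmorphB rmorphXn rmorph1 rmorph_nat.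
by rewrite coefCM.
Qed.

End GeneratingFunction.

Lemma sum_widen (f : nat -> int) (a K : nat) : a <= K ->
  (forall s, a <= s -> f s = 0%R) -> (\sum_(s < K) f s = \sum_(s < a) f s)%R.
Proof.
move=> aK f0; rewrite -(subnKC aK) big_split_ord /= [X in (_ + X)%R]big1 ?addr0 //.
by move=> i _; apply: f0; exact: leq_addr.
Qed.

Lemma graph_number_production n p K : 0 < n -> n < K ->
  ((graph_number n.+1 p)%:Z = \sum_(q < K)
    (if (p <= q.+1)%N then 2 ^+ (q + 2 - p)%N - 1 else 0) * (graph_number n q)%:Z)%R.
Proof.
move=> n0 nK; rewrite (@graph_number_weight n.+1) //.
(* Here [s] stands for the exponent [p + q] of [B], which belongs to degree [s - 1]. *)
pose T s : int := ((if (p <= s)%N then 2 ^+ (s.+1 - p)%N - 1 else 0)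
  * (if s is d.+1 then (graph_number n d)%:Z else 0))%R.
have T0 s : n.+2 <= s -> T s = 0%R.
  by case: s => // s ns; rewrite /T graph_number_gt ?mulr0.
transitivity (\sum_(s < n.+2) T s)%R.
  (* The first [p] terms vanish, and the other [n.+3] match the powers kept by the truncation at
     [n.+1]. *)
  rewrite -(@sum_widen _ _ (p + n.+3)) //; last by lia.
  rewrite big_split_ord /= [X in (_ = X + _)%R]big1 ?add0r; last first.
    by move=> i _; rewrite /T leqNgt ltn_ord mul0r.
  apply: eq_bigr => q _; rewrite /T leq_addr -addnS addKn; congr (_ * _)%R.
  (* Exponent 0 gives the constant 1, whose coefficient at [n > 0] is 0. *)
  case: (p + q) => [|d]; first by rewrite expr0 coef1; case: (n) n0.
  by rewrite coef_block_exp ?leqnSn // gtn_eqF.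
rewrite -(@sum_widen _ _ K.+1) // big_ord_recl {1}/T mulr0 add0r.
apply: eq_bigr => q _; rewrite lift0 /T; congr (_ * _)%R.
by rewrite addn2.
Qed.

(** * Points in convex position *)

From mathcomp Require Import boolp classical_sets reals.
Local Open Scope ring_scope.

Section Orientation.
Variable R : realType.
Local Notation point := 'rV[R]_2.
Implicit Types a b c d x y : point.

Lemma orientation_affine a b c d t :
  orientation a b ((1 - t) *: c + t *: d)
    = (1 - t) * orientation a b c + t * orientation a b d.
Proof. by rewrite /orientation !mxE; ring. Qed.

Lemma orientation_cycle a b c : orientation b c a = orientation a b c.
Proof. by rewrite /orientation; ring. Qed.

Lemma orientation_swap a b c : orientation a c b = - orientation a b c.
Proof. by rewrite /orientation; ring. Qed.

Lemma orientation_refl a b : orientation a b a = 0 /\ orientation a b b = 0.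
Proof. by split; rewrite /orientation; ring. Qed.

Lemma orientation_segment a b x : segment a b x -> orientation a b x = 0.
Proof.
move=> [t [_ ->]]; rewrite orientation_affine; have [-> ->] := orientation_refl a b.
by rewrite !mulr0 addr0.
Qed.

Lemma point_eq a b : a 0 0 = b 0 0 -> a 0 1 = b 0 1 -> a = b.
Proof.
move=> e0 e1; apply/rowP => i; case: (unliftP 0 i) => [j|] ->; last exact: e0.
by rewrite ord1 (_ : lift 0 0 = 1) //; apply: val_inj.
Qed.

Lemma open_segmentW a b x : open_segment a b x -> segment a b x.
Proof. by move=> [t [/andP[t0 t1] ->]]; exists t; rewrite !ltW. Qed.

Lemma segmentC a b x : segment a b x -> segment b a x.
Proof.
move=> [t [t01 ->]]; exists (1 - t); split; first by lra.
by rewrite addrC; congr (_ *: _ + _); ring.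
Qed.

Lemma open_segmentC a b x : open_segment a b x -> open_segment b a x.
Proof.
move=> [t [t01 ->]]; exists (1 - t); split; first by lra.
by rewrite addrC; congr (_ *: _ + _); ring.
Qed.

(* The diagonals of a convex quadrilateral meet; the weights are the areas of
   the two triangles cut off by the other diagonal. *)
Lemma diagonals_meet a b c d :
  0 < orientation a b c -> 0 < orientation a b d ->
  0 < orientation a c d -> 0 < orientation b c d ->
  exists x, open_segment a c x /\ open_segment b d x.
Proof.
move=> abc abd acd bcd.
(* Either diagonal cuts the quadrilateral into two triangles; both sums are twice its area. *)
have area : orientation a b c + orientation a c d
          = orientation a b d + orientation b c d.
  by rewrite /orientation; ring.
pose s := orientation a b c + orientation a c d.
have s0 : 0 < s by rewrite addr_gt0.
exists ((1 - orientation a b c / s) *: b + (orientation a b c / s) *: d).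
have frac u v : 0 < u -> 0 < v -> u + v = s -> 0 < u / s < 1.
  move=> u0 v0 uv; rewrite divr_gt0 //= ltr_pdivrMr // mul1r; lra.
split; last by exists (orientation a b c / s); split=> //; exact: frac acd _.
exists (orientation a b d / s); split; first exact: frac bcd _.
have s_neq0 : s != 0 by rewrite gt_eqF.
have combine u v w : (1 - u / s) * v + u / s * w = ((s - u) * v + u * w) / s by field.
by apply: point_eq; rewrite !mxE !combine; congr (_ / _); rewrite /s /orientation; ring.
Qed.

End Orientation.

Section Positions.
Variables (R : realType) (m : nat) (p : 'I_m -> 'rV[R]_2) (x : 'rV[R]_2).
Hypothesis ccw : ccw_labelled (add_point p x).
Implicit Types (E : {set {set 'I_m}}) (u v w z k : 'I_m).

Lemma ccw_points u v w : (u < v < w)%N -> 0 < orientation (p u) (p v) (p w).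
Proof.
have := ccw (i := lift ord_max u) (j := lift ord_max v) (k := lift ord_max w).
by rewrite /add_point !liftK !lift_max.
Qed.

Lemma ccw_new_point u v : (u < v)%N -> 0 < orientation (p u) (p v) x.
Proof.
have := ccw (i := lift ord_max u) (j := lift ord_max v) (k := ord_max).
by rewrite /add_point !liftK unlift_none !lift_max /= ltn_ord andbT.
Qed.

Lemma orientation_outside u v k : (u < v)%N -> (k < u)%N || (v < k)%N ->
  0 < orientation (p u) (p v) (p k).
Proof.
move=> uv /orP[ku|vk]; last by apply: ccw_points; rewrite uv.
by rewrite orientation_cycle ccw_points // ku.
Qed.

Lemma orientation_inside u v k : (u < k < v)%N ->
  orientation (p u) (p v) (p k) < 0.
Proof. by move=> ukv; rewrite orientation_swap oppr_lt0 ccw_points. Qed.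

Lemma orientation_zero u v k : (u < v)%N ->
  orientation (p u) (p v) (p k) = 0 -> k = u \/ k = v.
Proof.
move=> uv o0; have [ku|uk|/val_inj->] := ltngtP k u; last by left.
  by have := @orientation_outside u v k uv; rewrite ku o0 ltxx => /(_ isT).
have [kv|vk|/val_inj->] := ltngtP k v; last by right.
  by have := @orientation_inside u v k; rewrite uk kv o0 ltxx => /(_ isT).
by have := @orientation_outside u v k uv; rewrite vk orbT o0 ltxx => /(_ isT).
Qed.

(** Exactly the labels strictly between [u] and [v] lie on the negative side of the line. An edge
    from such a label cannot pass [u] or [v] without alternating with the edge [u v]. *)
Lemma edges_same_side E u v w z : noncrossing E -> (u < v)%N ->
  adjacent E u v -> adjacent E w z ->
  0 <= orientation (p u) (p v) (p w) * orientation (p u) (p v) (p z).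
Proof.
move=> /noncrossingP nE uv Euv Ewz.
pose inside k := (u < k < v)%N.
have side k : (0 <= orientation (p u) (p v) (p k)) || inside k.
  have [//|nk] := boolP (inside k); rewrite ?orbT // orbF.
  have [ku|uk|/val_inj->] := ltngtP k u.
  - by rewrite ltW // orientation_outside // ku.
  - have [kv|vk|/val_inj->] := ltngtP k v.
    + by rewrite /inside uk kv in nk.
    + by rewrite ltW // orientation_outside // vk orbT.
    + by have [_ ->] := orientation_refl (p u) (p v).
  - by have [-> _] := orientation_refl (p u) (p v).
have swap a b : adjacent E a b -> inside a ->
    orientation (p u) (p v) (p b) <= 0.
  move=> Eab /andP[ua av]; have [bu|ub|/val_inj->] := ltngtP b u.
  - by case: (nE b a u v) => //; rewrite adjacentC.
  - have [bv|vb|/val_inj->] := ltngtP b v.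
    + by rewrite ltW // orientation_inside // ub.
    + by case: (nE u v a b).
    + by have [_ ->] := orientation_refl (p u) (p v).
  - by have [-> _] := orientation_refl (p u) (p v).
have [w0|wI] := orP (side w); have [z0|zI] := orP (side z).
- exact: mulr_ge0.
- have := swap z w; rewrite adjacentC => /(_ Ewz zI) w1.
  have -> : orientation (p u) (p v) (p w) = 0 by apply: le_anti; rewrite w1 w0.
  by rewrite mul0r.
- have z1 := swap w z Ewz wI.
  have -> : orientation (p u) (p v) (p z) = 0 by apply: le_anti; rewrite z1 z0.
  by rewrite mulr0.
- have := swap z w; rewrite adjacentC => /(_ Ewz zI) w1.
  have z1 := swap w z Ewz wI.
  exact: mulr_le0.
Qed.

(** Alternating edges are diagonals of a convex quadrilateral and share no endpoint. *)
Lemma plane_noncrossing E : plane_graph p E -> noncrossing E.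
Proof.
move=> plE; apply/noncrossingP => u v w z uw wv vz Euv Ewz.
have [y [yuv ywz]] : exists y, open_segment (p u) (p v) y /\ open_segment (p w) (p z) y.
  by apply: diagonals_meet; apply: ccw_points; lia.
have ne : [set u; v]%SET != [set w; z]%SET.
  by rewrite (eq_pair (ltn_trans uw wv) (ltn_trans wv vz)) negb_and -val_eqE /= ltn_eqF.
have [k] := plE u v w z Euv Ewz ne y (open_segmentW yuv) (open_segmentW ywz).
rewrite !inE -!val_eqE /= => /andP[]; lia.
Qed.

(** A common point lies on the line of [u v], and the ends of the other edge are on one side of it,
    so the point is an end with orientation 0, that is, a shared endpoint. *)
Lemma noncrossing_plane E : is_graph E -> noncrossing E -> plane_graph p E.
Proof.
move=> gE nE u v w z.
wlog uv : u v / (u < v)%N.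
  move=> H Euv Ewz ne y yuv ywz.
  have [uv|vu|/val_inj uv] := ltngtP u v; first exact: (H u v).
    rewrite finset.setUC; apply: (H v u) => //.
    - by rewrite adjacentC.
    - by rewrite finset.setUC.
    exact: segmentC.
  by have := adjacent_neq gE Euv; rewrite uv eqxx.
move=> Euv Ewz ne y yuv [t [t01 yE]].
have side := edges_same_side nE uv Euv Ewz.
have := orientation_segment yuv; rewrite yE orientation_affine.
have zero := @orientation_zero u v _ uv.
have [w0|w0] := eqVneq (orientation (p u) (p v) (p w)) 0.
  have [z0|z0] := eqVneq (orientation (p u) (p v) (p z)) 0.
    have := adjacent_neq gE Ewz.
    case: (zero _ w0) ne => ->; case: (zero _ z0) => ->; rewrite ?eqxx //.
    by rewrite finset.setUC eqxx.
  rewrite w0 mulr0 add0r => /eqP; rewrite mulf_eq0 (negPf z0) orbF => /eqP t0.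
  exists w; last by rewrite t0 subr0 scale1r scale0r addr0.
  by rewrite !inE eqxx andbT; case: (zero _ w0) => ->; rewrite eqxx ?orbT.
have [z0|z0] := eqVneq (orientation (p u) (p v) (p z)) 0.
  rewrite z0 mulr0 addr0 => /eqP; rewrite mulf_eq0 (negPf w0) orbF subr_eq0 => /eqP t1.
  exists z; last by rewrite -t1 subrr scale1r scale0r add0r.
  by rewrite !inE eqxx orbT andbT; case: (zero _ z0) => ->; rewrite eqxx ?orbT.
(* With both ends strictly on one side, multiplying the equation by [a] makes a convex combination
   of positive numbers vanish. *)
move: side w0 z0 t01; move: (orientation _ _ (p w)) (orientation _ _ (p z)) => a b.
move=> ab a0 b0 t01 e; exfalso.
have ab0 : 0 < a * b by rewrite lt_neqAle ab eq_sym mulf_neq0.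
have aa0 : 0 < a * a by rewrite lt_neqAle eq_sym mulf_neq0 //= -expr2 sqr_ge0.
have : (1 - t) * (a * a) + t * (a * b) = 0 by rewrite mulrCA (mulrCA t) -mulrDr e mulr0.
move: ab0 aa0; move: (a * a) (a * b) => c d; nra.
Qed.

(** A covering edge [u v] and the segment from [p k] to [x] are the diagonals of the quadrilateral
    with corners [u], [k], [v], [x]. *)
Lemma visible_uncovered E k : visible p E x (p k) -> ~~ covered E k.
Proof.
move=> vk; apply/coveredP => -[u [v [uk kv Euv]]].
have [y [yuv ykx]] : exists y, open_segment (p u) (p v) y /\ open_segment (p k) x y.
  apply: diagonals_meet; try by [apply: ccw_points; lia | apply: ccw_new_point; lia].
have : set0 y by rewrite -(vk u v Euv); split=> //; exact/segmentC/open_segmentW.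
by [].
Qed.

Lemma uncovered_visible E k : is_graph E -> ~~ covered E k -> visible p E x (p k).
Proof.
move=> gE ck u v.
wlog uv : u v / (u < v)%N.
  move=> H Euv; have [uv|vu|/val_inj uv] := ltngtP u v; first exact: (H u v).
    rewrite -(H v u) //; last by rewrite adjacentC.
    by congr (_ `&` _)%classic; apply/seteqP; split=> y; exact: open_segmentC.
  by have := adjacent_neq gE Euv; rewrite uv eqxx.
move=> Euv; apply/seteqP; split=> // y [[t [t01 yE]] yuv].
have x0 := ccw_new_point uv.
have k0 : 0 <= orientation (p u) (p v) (p k).
  have [ku|uk|/val_inj->] := ltngtP k u.
  - by rewrite ltW // orientation_outside // ku.
  - have := uncoveredP ck Euv uk; rewrite leq_eqVlt => /orP[/eqP/val_inj <-|vk].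
      by have [_ ->] := orientation_refl (p u) (p v).
    by rewrite ltW // orientation_outside // vk orbT.
  - by have [-> _] := orientation_refl (p u) (p v).
have := orientation_segment (open_segmentW yuv).
rewrite yE orientation_affine => e.
(* The new point is strictly on the positive side of the edge and [p k] is not on the negative one,
   so only [p k] can be the meeting point. *)
have t1 : t = 1.
  apply/eqP; rewrite eq_le; have /andP[_ ->] := t01; rewrite /= leNgt; apply/negP => t1.
  have : 0 < (1 - t) * orientation (p u) (p v) x by rewrite mulr_gt0 // subr_gt0.
  have : 0 <= t * orientation (p u) (p v) (p k) by rewrite mulr_ge0 //; case/andP: t01.
  lra.
have yk : y = p k by rewrite yE t1 subrr scale0r scale1r add0r.
move: e; rewrite t1 subrr mul0r mul1r add0r => /(orientation_zero uv) kuv.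
have [r [r01 yE']] := yuv; have /andP[r0 r1] := r01.
(* An interior point of the edge is strictly off the lines from [x] to either end, so it is neither
   [p u] nor [p v]. *)
have : 0 < orientation (p v) x y.
  rewrite yE' orientation_affine; have [-> _] := orientation_refl (p v) x.
  by rewrite mulr0 addr0 orientation_cycle mulr_gt0 // subr_gt0.
have : 0 < orientation x (p u) y.
  rewrite yE' orientation_affine; have [_ ->] := orientation_refl x (p u).
  by rewrite mulr0 add0r -orientation_cycle mulr_gt0.
rewrite yk; case: kuv => ->.
  by have [_ ->] := orientation_refl x (p u); rewrite ltxx.
by have [-> _] := orientation_refl (p v) x; rewrite ltxx.
Qed.

End Positions.

(** * From geometric graphs to the combinatorial counts *)

Lemma visibility_degreeE (R : realType) l (p : 'I_l.+2 -> 'rV[R]_2) x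
    (E : {set {set 'I_l.+2}}) : ccw_labelled (add_point p x) ->
  E \in interval_graphs l.+2 0 l.+1 ->
  visibility_degree p x E = degree E 0 l.+1.
Proof.
move=> ccw GE; have /interval_graphsP[gE _ _ _] := GE.
have [c0 c1] := boundary_uncovered GE.
rewrite /visibility_degree.
have -> : #|[pred k | `[< visible p E x (p k) >]]|
    = #|[set k : 'I_l.+2 | ~~ covered E k]%SET|.
  apply: eq_card => k; rewrite !inE; apply/asboolP/idP.
    exact: (visible_uncovered ccw).
  exact: (uncovered_visible ccw).
(* The first and last vertices are distinct and uncovered; they are the 2 being subtracted. *)
rewrite (cardsD1 ord0) inE c0 (cardsD1 ord_max) !inE c1 -val_eqE /= add1n add1n subn2 /=.
apply: eq_card => k; rewrite !inE -!val_eqE /=.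
by have := ltn_ord k; case: (covered E k) => /=; lia.
Qed.

Lemma connected_plane_graphsE (R : realType) l (p : 'I_l.+1 -> 'rV[R]_2) x :
  ccw_labelled (add_point p x) ->
  connected_plane_graphs p = interval_graphs l.+1 0 l.
Proof.
move=> ccw; apply/setP => E; rewrite inE; apply/and3P/interval_graphsP.
  move=> [gE cE /asboolP plE]; split=> //.
  - apply/supportedP => u v _; have := ltn_ord u; have := ltn_ord v; lia.
  - exact: (plane_noncrossing ccw plE).
  - by apply/connected_onP => u v _ _; move/'forall_forallP: cE; apply.
move=> [gE _ nE /connected_onP cE]; split=> //.
  apply/'forall_forallP => u v; have := ltn_ord u; have := ltn_ord v.
  by move=> ? ?; apply: cE; lia.
by apply/asboolP; exact: (noncrossing_plane ccw).
Qed.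

Lemma visibility_vectorE (R : realType) n l (p : 'I_l.+2 -> 'rV[R]_2) x (j : 'I_n) :
  ccw_labelled (add_point p x) ->
  visibility_vector p n x j 0 = (graph_number l.+1 j)%:Z.
Proof.
move=> ccw; rewrite mxE (connected_plane_graphsE ccw); congr Posz.
apply: eq_card => E; rewrite mem_degree_graphs inE.
by case: (boolP (E \in _)) => //= GE; rewrite (visibility_degreeE ccw).
Qed.

Theorem theorem11 (R : realType) (n : nat) (n_ge2 : (2 <= n)%N)
    (i : nat) (i_bounds : (2 <= i <= n)%N)
    (p : 'I_i -> 'rV[R]_2) (x : 'rV[R]_2)
    (p_convex : convex_ccw (add_point p x))
    (q : 'I_i.+1 -> 'rV[R]_2) (y : 'rV[R]_2)
    (q_convex : convex_ccw (add_point q y)) :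
  visibility_vector q n y = production_mx n *m visibility_vector p n x.
Proof.
case: i i_bounds p p_convex q q_convex => [|[|l]] // ln p [_ p_ccw] q [_ q_ccw].
apply/matrixP => j k; rewrite ord1 visibility_vectorE // mxE.
(* The [l.+2] vertices have length [l.+1 < n], so the [n] columns reach every degree that occurs. *)
rewrite (@graph_number_production _ _ n) //.
by apply: eq_bigr => s _; rewrite visibility_vectorE // mxE.
Qed.
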